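(* No BIPASS position has game value $*2$; that is, if $g$ is any disjunctive sum of finitely many BIPASS strips, then $g\not\equiv *2$.
   Context: **BIPASS.** A strip is a finite word over $\{B,W\}$ ($B$ = black stone, $W$ = white stone). Dead stones are removed immediately: a white stone with no black stone to its left, and a black stone with no white stone to its right, are deleted. So a strip is either the empty word (the game $0$) or a word beginning with $B$ and ending with $W$. A Left move chooses a black stone at position $i$ and a white stone at position $j>i$ with no black stone strictly between them, and interchanges the two; a Right move chooses a black stone at position $i$ and a white stone at position $j>i$ with no white stone strictly between them, and interchanges the two. After a move, dead stones (all leading $W$'s and all trailing $B$'s) are deleted. A position is a disjunctive sum of finitely many strips. Normal play: a player who cannot move loses. $\equiv$ is equality of normal-play game values; $*=\{0\mid 0\}$ and $*2=\{0,*\mid 0,*\}$. *)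

(* Defs.v *)
From HB Require Import structures.
From mathcomp Require Import all_boot.
From mathcomp Require Import zify.

Set Implicit Arguments.
Unset Strict Implicit.
Unset Printing Implicit Defensive.

(** Short normal-play games *)

Inductive game : Type := Game of seq game & seq game.

Definition zero : game := Game [::] [::].
Definition star : game := Game [:: zero] [:: zero].
Definition star2 : game := Game [:: zero; star] [:: zero; star].

Fixpoint add (g : game) : game -> game :=
  let: Game gL gR := g in
  fix add_g (h : game) : game :=
    let: Game hL hR := h in
    Game ([seq add x h | x <- gL] ++ [seq add_g y | y <- hL])
         ([seq add x h | x <- gR] ++ [seq add_g y | y <- hR]).

(** First component: Left wins when moving first; second component: Right wins
    when moving first.  The four possible values are the four outcome classes. *)
Fixpoint outcome (g : game) : bool * bool :=
  let: Game gL gR := g in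
  (has (fun x => ~~ (outcome x).2) gL, has (fun x => ~~ (outcome x).1) gR).

(** Equality of game values: [g] and [h] have the same outcome in every
    disjunctive sum. *)
Definition game_eq (g h : game) : Prop :=
  forall x : game, outcome (add g x) = outcome (add h x).

(** BIPASS *)

Inductive stone : Type := B | W.

Definition is_black (c : stone) : bool := if c is B then true else false.
Definition stone_of_bool (b : bool) : stone := if b then B else W.
Lemma is_blackK : cancel is_black stone_of_bool. Proof. by case. Qed.
HB.instance Definition _ := Equality.copy stone (can_type is_blackK).

Definition word := seq stone.

Definition is_strip (s : word) : bool :=
  (s == [::]) || (head W s == B) && (last B s == W).

Definition trim (s : word) : word :=
  let t := drop (index B s) s in rev (drop (index W (rev t)) (rev t)).

Definition swap (s : word) (i j : nat) : word :=
  set_nth W (set_nth W s i (nth W s j)) j (nth W s i).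

(** [c] does not occur strictly between positions [i] and [j]. *)
Definition none_between (c : stone) (s : word) (i j : nat) : bool :=
  all (fun k => nth W s k != c) (iota i.+1 (j - i.+1)).

(** Interchange of a black stone at [i] with a white stone at [j > i] over
    stones different from [c]: a Left move for [c = B], a Right move for
    [c = W]. *)
Definition legal (c : stone) (s : word) (i j : nat) : bool :=
  [&& i < j, j < size s, nth W s i == B, nth W s j == W & none_between c s i j].

Definition options (c : stone) (s : word) : seq word :=
  [seq trim (swap s p.1 p.2)
     | p <- [seq (i, j) | i <- iota 0 (size s), j <- iota 0 (size s)]
     & legal c s p.1 p.2].

(** The number of pairs of a black stone and a white stone to its right; every
    move decreases it, so it bounds the length of play. *)
Fixpoint inv (s : word) : nat :=
  if s is c :: s' then (if c is B then count_mem W s' else 0) + inv s' else 0.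

Fixpoint strip_game_rec (n : nat) (s : word) : game :=
  if n is m.+1 then
    Game [seq strip_game_rec m t | t <- options B s]
         [seq strip_game_rec m t | t <- options W s]
  else zero.

(** See [strip_gameE]: the fuel never runs out. *)
Definition strip_game (s : word) : game := strip_game_rec (inv s).+1 s.

Definition position_game (g : seq word) : game :=
  foldr add zero [seq strip_game s | s <- g].

Lemma inv_cat s t :
  inv (s ++ t) = inv s + inv t + count_mem B s * count_mem W t.
Proof.
elim: s => [|[] s IH] /=; first by rewrite addn0.
- rewrite IH count_cat mulnDl mul1n.
  by move: (count_mem W s) (count_mem W t) (inv s) (inv t) (_ * _) => *; lia.
- by rewrite IH.
Qed.

Lemma inv_trim s : inv (trim s) <= inv s.
Proof.
rewrite /trim; set t := drop (index B s) s.
have le_t : inv t <= inv s.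
  rewrite -[in leqRHS](cat_take_drop (index B s) s) inv_cat.
  by rewrite addnAC leq_addl.
apply: leq_trans le_t; set k := index _ _.
rewrite -[in leqRHS](revK t) -[in leqRHS](cat_take_drop k (rev t)) rev_cat.
by rewrite inv_cat -addnA leq_addr.
Qed.

Lemma trim_is_strip s : is_strip (trim s).
Proof.
rewrite /is_strip /trim; set t := drop (index B s) s.
have ht : t = [::] \/ exists u, t = B :: u.
  rewrite /t; elim: s {t} => [|[] s IH] /=; [by left|by right; exists s|].
  exact: IH.
case: ht => [-> //|[u ->]].
elim/last_ind: u => [//|u x IH].
have -> : rev (B :: rcons u x) = x :: rev (B :: u) by rewrite -rcons_cons rev_rcons.
case: x => /=; first exact: IH.
by rewrite rev_cons revK /= last_rcons.
Qed.

Lemma inv_swap c s i j : legal c s i j -> inv (swap s i j) < inv s.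
Proof.
case/and5P => lt_ij lt_js /eqP si /eqP sj _; rewrite /swap si sj.
have lt_is := ltn_trans lt_ij lt_js.
have def_s : s = take i s ++ B :: drop i.+1 s.
  by rewrite -si -drop_nth // cat_take_drop.
set u := take i s in def_s; set r := drop i.+1 s in def_s.
have sz_u : size u = i by rewrite size_takel // ltnW.
have def_r : r = take (j - i.+1) r ++ W :: drop (j - i.+1).+1 r.
  have nr : nth W r (j - i.+1) = W by rewrite nth_drop subnKC.
  rewrite -{1}nr -drop_nth ?cat_take_drop // size_drop; lia.
set v := take _ r in def_r; set w := drop _ r in def_r.
have sz_v : size v = j - i.+1.
  by rewrite size_takel // /r size_drop; lia.
have -> : set_nth W (set_nth W s i W) j B = u ++ W :: v ++ B :: w.
  apply: (@eq_from_nth _ W) => [|k _].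
    have := size_cat u (B :: r); rewrite -def_s def_r /= size_cat /= => sz_s.
    by rewrite !size_set_nth size_cat /= size_cat /=; lia.
  have hs : nth W s k = nth W (u ++ B :: v ++ W :: w) k by rewrite -def_r -def_s.
  rewrite !(nth_set_nth, nth_cat) /= nth_set_nth /= hs !nth_cat sz_u.
  case: (ltngtP k i) => [ki|ik|->]; last first.
  - by rewrite subnn /= ltn_eqF.
  - have -> : k - i = (k - i.+1).+1 by lia.
    rewrite /= !nth_cat sz_v.
    case: (eqVneq k j) => [->|nkj]; first by rewrite ltnn subnn.
    case: ifP => // h.
    by have -> : k - i.+1 - (j - i.+1) = (k - i.+1 - (j - i.+1)).-1.+1 by lia.
  - by rewrite ltn_eqF // (ltn_trans ki).
rewrite def_s def_r !inv_cat /= !inv_cat /= !count_cat /=.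
nia.
Qed.

Lemma inv_options c s t : t \in options c s -> inv t < inv s.
Proof.
case/mapP => -[i j]; rewrite mem_filter => /andP[/= lg _] ->.
exact: leq_ltn_trans (inv_trim _) (inv_swap lg).
Qed.

Lemma strip_game_rec_stable n m s :
  inv s < n -> inv s < m -> strip_game_rec n s = strip_game_rec m s.
Proof.
elim: n m s => [//|n IH] [//|m] s ltn ltm /=.
by congr Game; apply/eq_in_map => t /inv_options ht; apply: IH; lia.
Qed.

Lemma strip_gameE s :
  strip_game s = Game [seq strip_game t | t <- options B s]
                      [seq strip_game t | t <- options W s].
Proof.
rewrite {1}/strip_game /=; congr Game; apply/eq_in_map => t /inv_options ht;
  by apply: strip_game_rec_stable.
Qed.

(* Main.v *)
Require Import Defs.
From mathcomp Require Import all_boot.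
From mathcomp Require Import zify.

Set Implicit Arguments.
Unset Strict Implicit.
Unset Printing Implicit Defensive.

(** For every [n >= 2], at least one of the players wins [g + *n] when moving
    first, so [g + *n] is not a zero game and [g] does not have value [*n]; the
    theorem is the case [n = 2] (lemma [first_player_wins]).

    Mirroring a position (reversing the strips and exchanging the colours)
    exchanges the two players, so one may assume that [g] has at least as many
    white stones as black ones, and then the claim is that Left, moving first,
    wins [g + *n] (lemma [lead_big_nim]).  The difference between the number of
    white and of black stones measures Left's lead, in the manner of an atomic
    weight.  The argument rests on three facts.

    - A Right move lowers the lead by at most one, because at most one white
      stone dies: if the first black stone is jumped over, the next stone is
      again black ([count_white_options], [white_stones_move]).
    - If some strip has at least two black stones, Left can raise the lead by
      jumping the last black stone over all the white stones behind it, which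
      kills it and nothing else ([kill_black], [fat_move]).
    - Otherwise the position is thin: each strip is empty or [B W^k].  Every
      Right move in such a strip is an exchange of neighbours and changes the
      parity of [inv], and Left too has a move of this kind in every nonempty
      strip.  So Left wins as second player whenever the total parity of [inv]
      and of a nim heap of size at most one is even ([thin_parity]).  A heap of
      size at least two lets Left choose this parity ([nim_to_even]), and so
      does a strip [B W^k] with [k >= 2], where Left can lower [inv] by one or
      by two.

    With a lead of at least one Left therefore wins moving first whatever the
    heap is, and with a lead of at least two also moving second: Left raises
    the lead while a strip with two black stones is left, and plays for parity
    afterwards ([lead_any_nim]).  If the heap has size at least two, one unit
    less of lead suffices for both conclusions: a thin position then needs no
    lead, and if Right reduces the heap while Left has a lead of one, Left is on
    move and wins by the previous statement ([lead_big_nim]). *)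

(** Here [inv] counts inversions; the bare name is also that of the inverse in a
    group. *)
Local Notation inv := Defs.inv.

Definition opp (c : stone) : stone := if c is B then W else B.

Lemma oppK : involutive opp. Proof. by case. Qed.

Lemma opp_eq c d : (opp c == d) = (c == opp d). Proof. by case: c d => [] []. Qed.

Lemma neq_opp c d : (c != d) = (c == opp d). Proof. by case: c d => [] []. Qed.

(** * Moves as jumps *)

Lemma set_nth_mid (T : Type) (d x y : T) u v :
  set_nth d (u ++ x :: v) (size u) y = u ++ y :: v.
Proof. by elim: u => [|z u IH] //=; rewrite IH. Qed.

Lemma nth_mid (T : Type) (d x : T) u v : nth d (u ++ x :: v) (size u) = x.
Proof. by rewrite nth_cat ltnn subnn. Qed.

Lemma split_nth (T : Type) (d : T) s i :
  i < size s -> s = take i s ++ nth d s i :: drop i.+1 s.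
Proof. by move=> lt_is; rewrite -drop_nth // cat_take_drop. Qed.

Lemma swap_ends u m v :
  swap (u ++ B :: m ++ W :: v) (size u) (size u + (size m).+1)
  = u ++ W :: m ++ B :: v.
Proof.
have regroup x w : u ++ x :: m ++ w = (u ++ x :: m) ++ w by rewrite -catA.
have sz x : size u + (size m).+1 = size (u ++ x :: m) by rewrite size_cat.
rewrite /swap nth_mid set_nth_mid {1}(sz B) {1}(regroup B) nth_mid.
by rewrite (sz W) regroup set_nth_mid -regroup.
Qed.

Lemma legal_ends c u m v :
  legal c (u ++ B :: m ++ W :: v) (size u) (size u + (size m).+1)
  = all (predC1 c) m.
Proof.
have lt_ends : size u < size u + (size m).+1 by rewrite addnS ltnS leq_addr.
have lt_end : size u + (size m).+1 < size (u ++ B :: m ++ W :: v).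
  by rewrite size_cat /= size_cat /=; lia.
rewrite /legal lt_ends lt_end nth_mid eqxx /=.
have -> : nth W (u ++ B :: m ++ W :: v) (size u + (size m).+1) = W.
  by rewrite -cat_cons catA -(size_cat u (B :: m)) nth_mid.
rewrite eqxx /= /none_between addnS subSS addKn.
rewrite -(all_map (nth W (u ++ B :: m ++ W :: v)) (predC1 c)) map_nth_iota.
  by rewrite -cat_rcons drop_size_cat ?size_rcons // take_size_cat.
by lia.
Qed.

(** A move of either player is the exchange of the two ends of a block
    [B m W] where all of [m] has the opponent's colour: Left's black stone jumps
    right over a run of white ones, Right's white stone left over a run of black
    ones.  This form is manifestly symmetric under mirroring. *)
Lemma optionsP c s t :
  reflect (exists u k v, s = u ++ B :: nseq k (opp c) ++ W :: v
             /\ t = trim (u ++ W :: nseq k (opp c) ++ B :: v))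
          (t \in options c s).
Proof.
apply: (iffP mapP) => [[[i j]]|[u [k [v [-> ->]]]]].
  rewrite mem_filter => /andP[/= lg _] ->; move: lg.
  move=> lg; case/and5P: (lg) => lt_ij lt_js /eqP si /eqP sj _.
  have lt_is := ltn_trans lt_ij lt_js.
  have := split_nth W lt_is; set u := take i s; set r := drop i.+1 s; rewrite si.
  have lt_jr : j - i.+1 < size r by rewrite size_drop; lia.
  have := split_nth W lt_jr; rewrite {2}/r nth_drop subnKC // sj.
  set m := take _ r; set v := drop _ r => def_r; rewrite {}def_r => def_s.
  have sz_u : size u = i by rewrite size_takel // ltnW.
  have sz_m : size m = j - i.+1 by rewrite size_takel // ltnW.
  have def_j : j = size u + (size m).+1 by rewrite sz_u sz_m; lia.
  exists u, (size m), v.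
  suff <- : m = nseq (size m) (opp c).
    by split=> //; rewrite {1}def_s def_j -[X in swap _ X]sz_u swap_ends.
  apply/all_pred1P; move: lg; rewrite {1}def_s def_j -{1}sz_u legal_ends.
  by apply/sub_all=> x /=; rewrite neq_opp.
set m := nseq k (opp c); exists (size u, size u + (size m).+1); last first.
  by rewrite /= swap_ends.
rewrite mem_filter /= legal_ends all_nseq /= neq_opp eqxx orbT /=.
by apply: allpairs_f; rewrite mem_iota !size_cat /= size_cat /=; lia.
Qed.

(** * Trimming *)

Lemma split_prefix c s :
  s = nseq (index (opp c) s) c ++ drop (index (opp c) s) s.
Proof. by elim: s => [|x s IH] //=; case: c x IH => [] [] //= IH; congr cons. Qed.

Lemma trim_spec s : exists a b, s = nseq a W ++ trim s ++ nseq b B.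
Proof.
rewrite /trim; set t := drop (index B s) s.
exists (index B s), (index W (rev t)); rewrite {1}(split_prefix W s) /= -/t.
congr cat; rewrite -[LHS]revK -[nseq _ B]rev_nseq -rev_cat.
by congr rev; exact: (split_prefix B).
Qed.

Lemma index_nseq_cat c a s : index (opp c) (nseq a c ++ s) = a + index (opp c) s.
Proof. by elim: a => //= a ->; case: c. Qed.

(** [trim_spec] determines [trim s]: the padding removed on the two sides is
    visible from any such decomposition, which allows to compute [trim] without
    unfolding it. *)
Lemma trim_padded a b t : is_strip t -> trim (nseq a W ++ t ++ nseq b B) = t.
Proof.
move=> strip_t; rewrite /trim (@index_nseq_cat W) addnC -drop_drop.
rewrite drop_size_cat ?size_nseq //.
have -> : index B (t ++ nseq b B) = 0.
  by case/orP: strip_t => [/eqP->|]; [case: b|case: t => [|[]]].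
rewrite drop0 rev_cat rev_nseq (@index_nseq_cat B) addnC -drop_drop.
rewrite drop_size_cat ?size_nseq //.
suff -> : index W (rev t) = 0 by rewrite drop0 revK.
case/orP: strip_t => [/eqP->//|/andP[_]].
by case/lastP: t => // u x; rewrite last_rcons rev_rcons /= => /eqP->.
Qed.

Lemma inv_nseq n c : inv (nseq n c) = 0.
Proof. by elim: n => //= n ->; case: c; rewrite ?count_nseq. Qed.

(** Dead stones form no pair of a black stone and a white stone to its right. *)
Lemma inv_trim_eq s : inv (trim s) = inv s.
Proof.
have [a [b e]] := trim_spec s; rewrite {2}e !inv_cat !inv_nseq !count_cat.
by rewrite !count_nseq /= !mul0n !muln0 !addn0.
Qed.

(** * Moves of positions *)

Inductive move (c : stone) : seq word -> seq word -> Prop :=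
  Move g1 s t g2 of t \in options c s : move c (g1 ++ s :: g2) (g1 ++ t :: g2).

Definition win (c : stone) (G : game) : bool :=
  if c is B then (outcome G).1 else (outcome G).2.

Definition opts (c : stone) (G : game) : seq game :=
  let: Game GL GR := G in if c is B then GL else GR.

Fixpoint nims (n : nat) : seq game :=
  if n is m.+1 then rcons (nims m) (Game (nims m) (nims m)) else [::].

Definition nim (n : nat) : game := Game (nims n) (nims n).

Definition position_nim (g : seq word) (n : nat) : game :=
  add (position_game g) (nim n).

Lemma winE c G : win c G = has (fun x => ~~ win (opp c) x) (opts c G).
Proof. by case: c G => [] []. Qed.

Lemma has_opts_add c P G H :
  has P (opts c (add G H))
  = has (fun x => P (add x H)) (opts c G) || has (fun y => P (add G y)) (opts c H).
Proof. by case: G H => [GL GR] [HL HR]; case: c; rewrite /= has_cat !has_map. Qed.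

Lemma opts_strip c s : opts c (strip_game s) = [seq strip_game t | t <- options c s].
Proof. by rewrite strip_gameE; case: c. Qed.

Lemma has_opts_position c (P : pred game) g :
  has P (opts c (position_game g))
  <-> exists2 g', move c g g' & P (position_game g').
Proof.
elim: g P => [|s g IH] P.
  split=> [|[g']]; first by case: c.
  by move e: [::] => h m; case: m e => - [].
rewrite -[position_game (s :: g)]/(add (strip_game s) (position_game g)).
rewrite has_opts_add opts_strip has_map; split.
  case/orP => [/hasP[t t_s Pt]|/IH[g' m Pg']].
    by exists (t :: g) => //; apply: (Move [::] g t_s).
  exists (s :: g') => //; case: m => g1 s' t g2 t_s'.
  exact: (Move (s :: g1) g2 t_s').
case=> g'; move e: (s :: g) => h m; case: m e => -[|s' g1] s1 t g2 t_s1 /= [-> e] Pg'.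
  by apply/orP; left; apply/hasP; exists t => //; rewrite e.
by apply/orP; right; apply/IH; exists (g1 ++ t :: g2); rewrite // e; apply: Move.
Qed.

Lemma opts_nim c n : opts c (nim n) = nims n.
Proof. by case: c. Qed.

Lemma has_nims P n : has P (nims n) <-> exists2 m, m < n & P (nim m).
Proof.
elim: n => [|n IH] /=; first by split=> // -[].
rewrite has_rcons; split=> [/orP[Pn|/IH[m lt_mn Pm]]|[m]].
- by exists n.
- by exists m => //; apply: ltnW.
- rewrite ltnS leq_eqVlt => /orP[/eqP-> Pn|lt_mn Pm]; apply/orP; first by left.
  by right; apply/IH; exists m.
Qed.

(** Playing the sum is playing on the pair of a list of strips and a heap size;
    all that follows reasons on such pairs only. *)
Lemma win_position c g n :
  win c (position_nim g n)
  <-> (exists2 g', move c g g' & ~~ win (opp c) (position_nim g' n))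
      \/ (exists2 m, m < n & ~~ win (opp c) (position_nim g m)).
Proof.
rewrite winE has_opts_add opts_nim; split.
  by case/orP=> [/has_opts_position|/has_nims]; [left|right].
by case=> h; apply/orP; [left; apply/has_opts_position|right; apply/has_nims].
Qed.

(** * The mirror symmetry *)

Definition mirror (s : word) : word := rev (map opp s).

Lemma mirrorK : involutive mirror.
Proof. by move=> s; rewrite /mirror map_rev revK (mapK oppK). Qed.

Lemma mirror_cat s t : mirror (s ++ t) = mirror t ++ mirror s.
Proof. by rewrite /mirror map_cat rev_cat. Qed.

Lemma mirror_nseq n c : mirror (nseq n c) = nseq n (opp c).
Proof. by rewrite /mirror map_nseq rev_nseq. Qed.

Lemma count_mirror c s : count_mem c (mirror s) = count_mem (opp c) s.
Proof.
by rewrite /mirror count_rev count_map; apply: eq_count => x /=; rewrite opp_eq.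
Qed.

Lemma mirror_strip s : is_strip (mirror s) = is_strip s.
Proof.
have fwd t : is_strip t -> is_strip (mirror t).
  case/orP=> [/eqP->//|]; rewrite /mirror.
  case: t => [//|x t] /andP[/= /eqP->] {x}.
  case/lastP: t => [//|t y]; rewrite last_rcons => /eqP->.
  by rewrite /is_strip /= map_rcons rev_cons rev_rcons /= last_rcons.
by apply/idP/idP => /fwd //; rewrite mirrorK.
Qed.

Lemma trim_mirror s : trim (mirror s) = mirror (trim s).
Proof.
have [a [b e]] := trim_spec s.
rewrite {1}e !mirror_cat !mirror_nseq -catA trim_padded //.
by rewrite mirror_strip trim_is_strip.
Qed.

Lemma inv_mirror s : inv (mirror s) = inv s.
Proof.
elim: s => [//|c s IH]; rewrite -cat1s mirror_cat inv_cat IH.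
rewrite !count_mirror; case: c => /=; lia.
Qed.

Lemma mirror_options c s t :
  t \in options c s -> mirror t \in options (opp c) (mirror s).
Proof.
case/optionsP=> u [k [v [-> ->]]]; apply/optionsP.
exists (mirror v), k, (mirror u); rewrite -trim_mirror.
have mirror_cons x w : mirror (x :: w) = rcons (mirror w) (opp x).
  by rewrite /mirror /= rev_cons.
by rewrite !(mirror_cat, mirror_cons) !mirror_nseq !cat_rcons -!catA.
Qed.

Definition invs (g : seq word) : nat := sumn (map inv g).

Lemma invs_mid g1 s g2 : invs (g1 ++ s :: g2) = inv s + invs (g1 ++ g2).
Proof. by rewrite /invs !map_cat !sumn_cat /= addnCA. Qed.

Lemma invs_move c g g' : move c g g' -> invs g' < invs g.
Proof. by case=> g1 s t g2 /inv_options; rewrite !invs_mid; lia. Qed.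

Lemma move_mirror c g g' :
  move c g g' -> move (opp c) (map mirror g) (map mirror g').
Proof. by case=> g1 s t g2 t_s; rewrite !map_cat; apply/Move/mirror_options. Qed.

(** Mirroring is negation of games.  Stated for winners rather than as an
    equality of games, since the options are listed in a different order. *)
Lemma win_mirror c g n :
  win (opp c) (position_nim (map mirror g) n) = win c (position_nim g n).
Proof.
(* One implication is enough, as mirroring twice is the identity. *)
suff fwd N d h m : invs h + m < N -> win d (position_nim h m) ->
    win (opp d) (position_nim (map mirror h) m).
  apply/idP/idP => [/(fwd _ _ _ _ (ltnSn _))|/(fwd _ _ _ _ (ltnSn _))//].
  by rewrite oppK (mapK mirrorK).
elim: N d h m => [//|N IH] d h m ltN.
have invs_mirror k : invs (map mirror k) = invs k.
  by rewrite /invs -map_comp; congr sumn; apply: eq_map => s; apply: inv_mirror.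
case/win_position => [[h' m_h lose]|[k lt_km lose]]; apply/win_position.
  left; exists (map mirror h'); first exact: move_mirror.
  apply: contra lose => w; have := IH _ _ _ _ w; have := invs_move m_h.
  by rewrite invs_mirror !oppK (mapK mirrorK) => lt_h; apply; lia.
right; exists k => //; apply: contra lose => w; have := IH _ _ _ _ w.
by rewrite invs_mirror !oppK (mapK mirrorK); apply; lia.
Qed.
(** * Single strips *)

Lemma count_trim c s : count_mem c (trim s) <= count_mem c s.
Proof.
by have [a [b e]] := trim_spec s; rewrite {2}e !count_cat addnCA leq_addr.
Qed.

Lemma count_options c d s t :
  t \in options c s -> count_mem d t <= count_mem d s.
Proof.
case/optionsP=> u [k [v [-> ->]]]; apply: leq_trans (count_trim _ _) _.
by rewrite !count_cat /= !count_cat /=; lia.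
Qed.

(** Only a white stone arriving at the left end of the strip dies, and it cannot
    be followed by another white stone: either it jumped over more than one
    black stone, or the black stone it was exchanged with is next. *)
Lemma count_white_options s t :
  is_strip s -> t \in options W s -> count_mem W s <= (count_mem W t).+1.
Proof.
move=> strip_s /optionsP[u [k [v [def_s ->]]]]; move: strip_s; rewrite def_s.
set r := u ++ W :: _; have [a [b e]] := trim_spec r.
have <- : count_mem W r = count_mem W (u ++ B :: nseq k B ++ W :: v).
  by rewrite !count_cat /= !count_cat /=; lia.
have -> : count_mem W r = a + count_mem W (trim r).
  by rewrite {1}e !count_cat !count_nseq /= mul1n mul0n addn0.
case: a e => [|[|a]] e; [lia|lia|].
(* Two dead white stones: the first two stones of [r] would be white. *)
move: e; rewrite /r; case: u {r def_s} => [|[] u] //=.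
by case: k => [|k] [].
Qed.

Lemma last_black s : B \in s -> exists u k, s = u ++ B :: nseq k W.
Proof.
elim/last_ind: s => // s x IH; rewrite mem_rcons inE; case: x => /=.
  by exists s, 0; rewrite cats1.
case/IH=> u [k ->]; exists u, k.+1.
by rewrite -cats1 -catA -addn1 nseqD.
Qed.

(** The last black stone jumps over all white stones behind it.  The first stone
    is another black one and stays, so all white stones remain alive. *)
Lemma kill_black s : is_strip s -> 1 < count_mem B s ->
  exists2 t, t \in options B s &
    count_mem W t = count_mem W s /\ count_mem B t < count_mem B s.
Proof.
move=> strip_s lt1.
have /last_black[u [k def_s]] : B \in s by rewrite -has_pred1 has_count; lia.
have def_k : k = k.-1.+1.
  by move: strip_s; rewrite def_s; case: k {def_s} => //; case: (u) => // x u';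
     rewrite /is_strip /= cats1 last_rcons andbF.
have strip_t : is_strip (u ++ nseq k W).
  move: lt1 strip_s; rewrite def_s def_k.
  case: (u) => [|x u'] /=; first by rewrite count_nseq mul0n.
  by rewrite /is_strip /= !last_cat /= => _ /andP[->]; elim: (k.-1).
exists (u ++ nseq k W); last by rewrite def_s !count_cat /=; lia.
apply/optionsP; exists u, k.-1, [::]; split.
  by rewrite def_s {1}def_k -addn1 nseqD.
(* The only dead stone is the black one at the right end. *)
by rewrite -[LHS](trim_padded 0 1) // def_k -catA.
Qed.

Lemma inv_swap_adjacent u v :
  inv (u ++ B :: W :: v) = (inv (u ++ W :: B :: v)).+1.
Proof. by rewrite !inv_cat /=; lia. Qed.

Lemma adjacent_move c s : 0 < inv s ->
  exists2 t, t \in options c s & inv s = (inv t).+1.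
Proof.
move=> inv_s; have [u [v def_s]] : exists u v, s = u ++ B :: W :: v.
  elim: s inv_s => [//|[] s IH] /=; last first.
    by case/IH=> u [v ->]; exists (W :: u), v.
  case: s IH => [//|[] s] IH inv_s; last by exists [::], s.
  by case: IH => [|u [v ->]]; [move: inv_s => /=; lia|exists (B :: u), v].
exists (trim (u ++ W :: B :: v)); first by apply/optionsP; exists u, 0, v.
by rewrite inv_trim_eq def_s inv_swap_adjacent.
Qed.

(** Such a strip is [B W^k] with [k >= 2], and the black stone jumps over two
    white ones.  Together with [adjacent_move] this lets Left choose the parity
    of [inv]. *)
Lemma double_move s : is_strip s -> count_mem B s <= 1 < count_mem W s ->
  exists2 t, t \in options B s & inv s = (inv t).+2.
Proof.
move=> strip_s /andP[le1 lt1].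
have /last_black[u [k def_s]] : B \in s.
  case/orP: strip_s lt1 => [/eqP->//|/andP[]].
  by case: (s) => // x s' /= /eqP->; rewrite inE.
have u0 : u = [::].
  move: strip_s le1; rewrite def_s /is_strip; case: (u) => [//|[] u'] //=.
  by rewrite count_cat /=; lia.
move: lt1; rewrite def_s u0 /= count_nseq mul1n; case: k {def_s} => [|[|k]] // _.
exists (trim (W :: W :: B :: nseq k W)).
  by apply/optionsP; exists [::], 1, (nseq k W).
by rewrite inv_trim_eq inv_nseq /= count_nseq inv_nseq mul1n.
Qed.

(** There is only one black stone to jump over. *)
Lemma white_move_thin s t :
  count_mem B s <= 1 -> t \in options W s -> inv s = (inv t).+1.
Proof.
move=> le1 /optionsP[u [k [v [def_s ->]]]]; rewrite inv_trim_eq def_s.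
suff -> : k = 0 by rewrite inv_swap_adjacent.
by move: le1; rewrite def_s count_cat /= count_cat count_nseq /=; lia.
Qed.

(** * Left's strategy *)

Definition stones (c : stone) (g : seq word) : nat := count_mem c (flatten g).

(** Positions in which Left cannot raise the lead by [kill_black]; they consist
    of empty strips and strips [B W^k]. *)
Definition thin (g : seq word) : bool := all (fun s => count_mem B s <= 1) g.

Lemma stones_mid c g1 s g2 :
  stones c (g1 ++ s :: g2) = count_mem c s + stones c (g1 ++ g2).
Proof. by rewrite /stones !flatten_cat /= !count_cat addnCA. Qed.

Lemma strips_move c g g' : move c g g' -> all is_strip g -> all is_strip g'.
Proof.
case=> g1 s t g2 /mapP[p _ ->]; rewrite !all_cat /= trim_is_strip.
by case/and3P=> -> _ ->.
Qed.

Lemma thin_move c g g' : move c g g' -> thin g -> thin g'.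
Proof.
case=> g1 s t g2 /(count_options B) le_ts; rewrite /thin !all_cat /=.
by case/and3P=> -> /(leq_trans le_ts)-> ->.
Qed.

Lemma stones_move c d g g' : move c g g' -> stones d g' <= stones d g.
Proof. by case=> g1 s t g2 /(count_options d); rewrite !stones_mid; lia. Qed.

Lemma white_stones_move g g' :
  all is_strip g -> move W g g' -> stones W g <= (stones W g').+1.
Proof.
move=> strip_g m; case: m strip_g => g1 s t g2 t_s.
rewrite all_cat /= => /and3P[_ strip_s _].
by have := count_white_options strip_s t_s; rewrite !stones_mid; lia.
Qed.

(** The balance equations are additive to avoid truncated subtraction. *)
Lemma move_in c s t g : s \in g -> t \in options c s ->
  exists2 g', move c g g' & invs g + inv t = invs g' + inv s
    /\ forall d, stones d g + count_mem d t = stones d g' + count_mem d s.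
Proof.
case/splitPr=> g1 g2 t_s; exists (g1 ++ t :: g2); first exact: Move.
by rewrite !invs_mid; split=> [|d]; rewrite ?stones_mid; lia.
Qed.

Definition left_first g n := win B (position_nim g n).
Definition left_second g n := ~~ win W (position_nim g n).

Lemma left_first_move g g' n : move B g g' -> left_second g' n -> left_first g n.
Proof. by move=> m sec; apply/win_position; left; exists g'. Qed.

Lemma left_first_nim g m n : m < n -> left_second g m -> left_first g n.
Proof. by move=> lt sec; apply/win_position; right; exists m. Qed.

Lemma left_secondI g n :
  (forall g', move W g g' -> left_first g' n) ->
  (forall m, m < n -> left_first g m) -> left_second g n.
Proof.
move=> mv nm; apply/negP => /win_position[[g' m]|[m m_n]] /negP; apply.
  exact: mv.
exact: nm.
Qed.

(** Every move of Right changes the parity of [invs g + n], since Right can only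
    exchange neighbours and the heap has at most one token.  Left answers with
    a move of the same kind, which exists because an odd number is nonzero. *)
Lemma thin_parity g n : thin g -> n <= 1 ->
  if odd (invs g + n) then left_first g n else left_second g n.
Proof.
have [N] := ubnP (invs g + n); elim: N g n => // N IH g n ltN thin_g le_n1.
case: ifP => par.
  (* Left takes the token of the heap, if there is one. *)
  case: n le_n1 ltN par => [|[|//]] _ ltN par; last first.
    apply: (@left_first_nim _ 0) => //.
    by have := IH g 0 _ thin_g isT; rewrite ifN; [apply; lia|lia].
  have [s s_g inv_s] : exists2 s, s \in g & 0 < inv s.
    apply/hasP; apply: contraTT par => /hasPn z; rewrite addn0.
    suff -> : invs g = 0 by [].
    elim: (g) z => [//|s h IHh] z; rewrite /invs /= -/(invs h) IHh.
      by have := z s (mem_head _ _); rewrite lt0n negbK => /eqP->.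
    by move=> t t_h; apply: z; rewrite inE t_h orbT.
  have [t t_s inv_t] := adjacent_move B inv_s.
  have [g' m [e _]] := move_in s_g t_s.
  apply: (left_first_move m); have := IH g' 0 _ (thin_move m thin_g) isT.
  by rewrite ifN; [apply; lia|lia].
apply: left_secondI => [g' m|m lt_mn].
  have := IH g' n _ (thin_move m thin_g) le_n1.
  have e : invs g = (invs g').+1.
    case: m thin_g => g1 s t g2 t_s; rewrite /thin all_cat /= => /and3P[_ le_s _].
    by have := white_move_thin le_s t_s; rewrite !invs_mid; lia.
  by rewrite ifT; [apply; lia|lia].
have := IH g m _ thin_g; rewrite ifT; [apply; lia|lia].
Qed.

Lemma fat_move g : all is_strip g -> ~~ thin g ->
  exists2 g', move B g g' & stones W g' = stones W g /\ stones B g' < stones B g.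
Proof.
move=> strip_g /allPn[s s_g]; rewrite -ltnNge => lt1.
have [t t_s [eW ltB]] := kill_black (allP strip_g _ s_g) lt1.
have [g' m [_ e]] := move_in s_g t_s; exists g' => //.
by have := e W; have := e B; lia.
Qed.

Lemma left_second_even g n : thin g -> n <= 1 -> ~~ odd (invs g + n) ->
  left_second g n.
Proof. by move=> thin_g le /negbTE e; have := thin_parity thin_g le; rewrite e. Qed.

(** Left reduces the heap to [0] or [1], whichever makes the parity even. *)
Lemma nim_to_even g n : thin g -> 1 < n -> left_first g n.
Proof.
move=> thin_g lt1; apply: (@left_first_nim _ (odd (invs g))); first lia.
by apply: left_second_even => //; lia.
Qed.

(** If the parity is odd or the heap is large, Left can make it even without
    using the lead.  If it is even, the lead provides a strip [B W^k] with
    [k >= 2], where a double jump keeps it even. *)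
Lemma thin_lead_left_first g n :
  all is_strip g -> thin g -> stones B g < stones W g -> left_first g n.
Proof.
move=> strip_g thin_g lt_BW.
have [|le1] := ltnP 1 n; first exact: nim_to_even.
have := thin_parity thin_g le1; case: ifP => // even_g _.
have [s s_g lt_s] : exists2 s, s \in g & count_mem B s < count_mem W s.
  apply/hasP; apply: contraTT lt_BW => /hasPn le.
  rewrite -leqNgt /stones; elim: (g) le => //= s h IHh le.
  rewrite !count_cat leq_add //.
    by rewrite leqNgt; apply: le; rewrite mem_head.
  by apply: IHh => t t_h; apply: le; rewrite inE t_h orbT.
have strip_s := allP strip_g _ s_g; have le_s := allP thin_g _ s_g.
have lt1 : 1 < count_mem W s.
  have : 0 < count_mem W s by lia.
  rewrite -has_count has_pred1 => W_s.
  have : 0 < count_mem B s; last by lia.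
  rewrite -has_count has_pred1; case/orP: strip_s W_s => [/eqP->//|/andP[]].
  by case: (s) => // x s' /= /eqP->; rewrite inE.
have [||t t_s inv_t] := @double_move s; rewrite ?le_s //.
have [g' m [e _]] := move_in s_g t_s; apply: (left_first_move m).
by apply: left_second_even; [apply: thin_move m _| |lia].
Qed.

(** The two claims support each other: moving first, Left raises a lead of one
    to two or the position is thin; moving second with a lead of two, Left has
    still a lead of one after any move of Right. *)
Lemma lead_any_nim g n : all is_strip g ->
  (stones B g < stones W g -> left_first g n) /\
  ((stones B g).+1 < stones W g -> left_second g n).
Proof.
have [N] := ubnP (invs g + n); elim: N g n => // N IH g n ltN strip_g.
split=> lt_BW.
  have [thin_g|fat_g] := boolP (thin g); first exact: thin_lead_left_first.
  have [g' m [eW ltB]] := fat_move strip_g fat_g.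
  apply: (left_first_move m); have lt_inv := invs_move m.
  by apply: (IH g' n _ (strips_move m strip_g)).2; lia.
apply: left_secondI => [g' m|m lt_mn].
  have lt_inv := invs_move m; have leB := stones_move B m.
  have leW := white_stones_move strip_g m.
  by apply: (IH g' n _ (strips_move m strip_g)).1; lia.
by apply: (IH g m _ strip_g).1; lia.
Qed.

(** The same recursion with one unit less of lead.  A thin position needs no lead
    at all because of [nim_to_even]; if Right reduces the heap, Left still has a
    lead of one and the move, and [lead_any_nim] applies. *)
Lemma lead_big_nim g n : all is_strip g -> 1 < n ->
  (stones B g <= stones W g -> left_first g n) /\
  (stones B g < stones W g -> left_second g n).
Proof.
move=> strip_g lt1n; have [N] := ubnP (invs g).
elim: N g strip_g => // N IH g strip_g ltN.
split=> le_BW.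
  have [thin_g|fat_g] := boolP (thin g); first exact: nim_to_even.
  have [g' m [eW ltB]] := fat_move strip_g fat_g.
  apply: (left_first_move m); have lt_inv := invs_move m.
  by apply: (IH g' (strips_move m strip_g) _).2; lia.
apply: left_secondI => [g' m|m lt_mn].
  have lt_inv := invs_move m; have leB := stones_move B m.
  have leW := white_stones_move strip_g m.
  by apply: (IH g' (strips_move m strip_g) _).1; lia.
exact: (lead_any_nim m strip_g).1.
Qed.

Lemma stones_mirror c g : stones c (map mirror g) = stones (opp c) g.
Proof.
rewrite /stones; elim: g => //= s g IH.
by rewrite !count_cat IH count_mirror.
Qed.

Lemma first_player_wins g n : all is_strip g -> 1 < n ->
  exists c, win c (position_nim g n).
Proof.
move=> strip_g lt1; case: (leqP (stones B g) (stones W g)) => [le|/ltnW le].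
  by exists B; apply: (lead_big_nim strip_g lt1).1.
exists W; rewrite -win_mirror.
apply: (lead_big_nim _ lt1).1; rewrite ?stones_mirror //.
by rewrite all_map; apply: sub_all strip_g => s /=; rewrite mirror_strip.
Qed.

Theorem theorem19 (g : seq word) (hg : all is_strip g) :
  ~ game_eq (position_game g) star2.
Proof.
move=> /(_ star2) out; have [c] := @first_player_wins g 2 hg isT.
by rewrite /win /position_nim (_ : nim 2 = star2) // out; case: c.
Qed.
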